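(* Let $0<\delta<2$, $\gamma\ge0$ and $t_2\ge0$ satisfy $$\gamma<\frac{-1+\sqrt{4nt_2+4nt_2^2+1}}{2(1+t_2)}\qquad\text{and}\qquad \frac{\gamma\mu_2}{\mu_1}<\frac{2n}{1+t_2}-n\delta+\gamma\le\frac{n+\gamma}{\delta\mu_1(1+t_2)} .$$ Then there exist constants $\alpha\ge0$ and $0<\rho<1$ such that, for the sequence of random iterates $\{x_k\}$ generated by the SSKM algorithm (defined in the context) with parameters $\delta,\gamma$ from any starting point $x_0\in\mathbb{R}^n$, the sequence $\{x_k\}$ converges almost surely and for all $k\ge0$ $$\mathbb{E}[d(x_{k+1},P)^2]\le\rho^k(1+\alpha)\,d(x_0,P)^2\quad\text{and}\quad \mathbb{E}[f(x_{k+1})]\le\frac{\mu_2(1+\alpha)}{2}\,\rho^k\,d(x_0,P)^2 .$$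
   Context: Setting: $A\in\mathbb{R}^{m\times n}$ has rows $a_1^T,\dots,a_m^T$ with $\|a_i\|=1$ for all $i$, $b\in\mathbb{R}^m$, and $P=\{x\in\mathbb{R}^n: Ax\le b\}$ is nonempty. $\|\cdot\|$ is the Euclidean norm, $d(x,P)=\inf_{z\in P}\|x-z\|$, $u^+=\max\{u,0\}$ (componentwise for vectors). Fix a sample size $\beta\in\{1,\dots,m\}$. SSKM algorithm (Stochastic-Momentum Sampling Kaczmarz Motzkin): given $x_0\in\mathbb{R}^n$ (deterministic), set $x_1=x_0$; for $k\ge1$, choose a subset $\tau_k\subseteq\{1,\dots,m\}$ of size $\beta$ uniformly at random, let $i^*\in\arg\max_{i\in\tau_k}(a_i^Tx_k-b_i)^+$ (ties broken by any rule), pick $j_k\in\{1,\dots,n\}$ uniformly at random ($\tau_k$, $j_k$ independent of each other and of the past), and set $$x_{k+1}=x_k-\delta\,(a_{i^*}^Tx_k-b_{i^*})^+a_{i^*}+\gamma\,(x_k-x_{k-1})_{j_k}e_{j_k},$$ where $(v)_j$ is the $j$th coordinate of $v$ and $e_j$ the $j$th standard unit vector of $\mathbb{R}^n$. The function $f:\mathbb{R}^n\to\mathbb{R}$ is $f(x)=\frac12\,\mathbb{E}_\tau\big[\big(\max_{i\in\tau}(a_i^Tx-b_i)^+\big)^2\big]$, where $\tau$ is a uniformly random $\beta$-element subset of $\{1,\dots,m\}$. Constants: $L>0$ is a Hoffman constant, i.e. $d(x,P)^2\le L^2\|(Ax-b)^+\|^2$ for all $x\in\mathbb{R}^n$; $\mu_1=\frac{1}{mL^2}$;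 $\mu_2=\min\{1,\frac{\beta}{m}\lambda_{\max}(A^TA)\}$. One has $0<\mu_1\le\mu_2\le1$. *)

(* Defs.v *)
From mathcomp Require Import all_boot all_order all_algebra.
From mathcomp Require Import all_classical all_reals all_analysis.

Set Implicit Arguments.
Unset Strict Implicit.
Unset Printing Implicit Defensive.

Import Order.TTheory GRing.Theory Num.Theory.
Import numFieldNormedType.Exports.

Local Open Scope classical_set_scope.
Local Open Scope ring_scope.

Section Geometry.
Context {R : realType}.

(* The library norm on matrices is the sup norm, hence this definition. *)
Definition enorm {n : nat} (v : 'cV[R]_n) : R :=
  Num.sqrt (\sum_(i < n) v i 0 ^+ 2).

Definition edistance {n : nat} (x : 'cV[R]_n) (S : set 'cV[R]_n) : R :=
  inf [set enorm (x - z) | z in S].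

Definition pos_part {m : nat} (u : 'cV[R]_m) : 'cV[R]_m :=
  map_mx (fun t => Num.max t 0) u.

Definition polyhedron {m n : nat} (A : 'M[R]_(m, n)) (b : 'cV[R]_m) :
    set 'cV[R]_n :=
  [set x | forall i, (A *m x) i 0 <= b i 0].

Definition arow {m n : nat} (A : 'M[R]_(m, n)) (i : 'I_m) : 'cV[R]_n :=
  (row i A)^T.

Definition residual {m n : nat} (A : 'M[R]_(m, n)) (b : 'cV[R]_m)
    (x : 'cV[R]_n) (i : 'I_m) : R :=
  pos_part (A *m x - b) i 0.

(* Meant for symmetric matrices: the set of eigenvalues is then finite and, in
   positive dimension, nonempty, so the supremum is a maximum. *)
Definition lambda_max {n : nat} (M : 'M[R]_n) : R :=
  sup [set a : R | eigenvalue M a].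

Definition hoffman_constant {m n : nat} (A : 'M[R]_(m, n)) (b : 'cV[R]_m)
    (L : R) : Prop :=
  0 < L /\
  forall x : 'cV[R]_n, edistance x (polyhedron A b) ^+ 2
    <= L ^+ 2 * enorm (pos_part (A *m x - b)) ^+ 2.

Definition mu1 (m : nat) (L : R) : R := (m%:R * L ^+ 2)^-1.

Definition mu2 {m n : nat} (A : 'M[R]_(m, n)) (beta : nat) : R :=
  Num.min 1 (beta%:R / m%:R * lambda_max (A^T *m A)).

Definition samples (m beta : nat) : {set {set 'I_m}} :=
  [set tau : {set 'I_m} | #|tau| == beta]%SET.

(* The maximum of nonnegative numbers over tau may start from 0 since tau is
   nonempty (beta > 0). *)
Definition sskm_f {m n : nat} (A : 'M[R]_(m, n)) (b : 'cV[R]_m) (beta : nat)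
    (x : 'cV[R]_n) : R :=
  2^-1 * (#|samples m beta|%:R^-1 *
    \sum_(tau in samples m beta)
       (\big[Num.max/0]_(i in tau) residual A b x i) ^+ 2).

End Geometry.

(* Random elements of finite types, which carry the discrete sigma-algebra. *)
Section DiscreteRandomElements.
Context {d : measure_display} {T : measurableType d} {R : realType}.
Variable P : probability T R.

Definition random_element {S : finType} (X : T -> S) : Prop :=
  forall B : set S, measurable (X @^-1` B).

Definition independent_elements {S U : finType} (X : T -> S) (Y : T -> U) :
    Prop :=
  forall (B : set S) (C : set U),
    P (X @^-1` B `&` Y @^-1` C) = (P (X @^-1` B) * P (Y @^-1` C))%E.

Definition uniform_on {S : finType} (D : {set S}) (X : T -> S) : Prop :=
  (forall w, X w \in D) /\
  (forall s, s \in D -> P (X @^-1` [set s]) = (#|D|%:R^-1)%:E).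

End DiscreteRandomElements.

(* All random choices made at steps 1, ..., k. *)
Definition history {T : Type} {m n : nat} (tau : nat -> T -> {set 'I_m})
    (i : nat -> T -> 'I_m) (j : nat -> T -> 'I_n) (k : nat) (w : T) :
    {ffun 'I_k -> {set 'I_m} * 'I_m * 'I_n} :=
  [ffun l : 'I_k => (tau l.+1 w, i l.+1 w, j l.+1 w)].

(* The processes tau, i, j are used from index 1 on; [i k] is the selected row
   i^* of step k.  Besides [i k] being a maximizer, the only constraint on
   tie-breaking is that the coordinate [j k] is drawn independently of it, so
   that any rule is covered: deterministic, depending on the past, or using
   extra randomness.  For a rule that is a function of the past and [tau k],
   [sskm_j_indep] just says that [j k] is independent of [tau k] and the past. *)
Record is_SSKM {d : measure_display} {T : measurableType d} {R : realType}
    (P : probability T R) {m n : nat} (A : 'M[R]_(m, n)) (b : 'cV[R]_m)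
    (beta : nat) (delta gamma : R) (x0 : 'cV[R]_n)
    (tau : nat -> T -> {set 'I_m}) (i : nat -> T -> 'I_m)
    (j : nat -> T -> 'I_n) (x : nat -> T -> 'cV[R]_n) : Prop := {
  sskm_tau_random : forall k, random_element (tau k.+1);
  sskm_i_random : forall k, random_element (i k.+1);
  sskm_j_random : forall k, random_element (j k.+1);
  sskm_tau_uniform : forall k, uniform_on P (samples m beta) (tau k.+1);
  sskm_j_uniform : forall k, uniform_on P [set: 'I_n]%SET (j k.+1);
  sskm_tau_indep : forall k,
    independent_elements P (tau k.+1) (history tau i j k);
  sskm_j_indep : forall k,
    independent_elements P (j k.+1)
      (fun w => (history tau i j k w, tau k.+1 w, i k.+1 w));
  sskm_argmax : forall k w, i k.+1 w \in tau k.+1 w /\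
    forall l, l \in tau k.+1 w ->
      residual A b (x k.+1 w) l <= residual A b (x k.+1 w) (i k.+1 w);
  sskm_init0 : forall w, x 0%N w = x0;
  sskm_init1 : forall w, x 1%N w = x0;
  sskm_step : forall k w,
    x k.+2 w = x k.+1 w
      - (delta * residual A b (x k.+1 w) (i k.+1 w)) *: arow A (i k.+1 w)
      + (gamma * (x k.+1 w - x k w) (j k.+1 w) 0) *: delta_mx (j k.+1 w) 0
}.

(* Main.v *)
(* For z in P, averaging the step over j_k and then over tau_k, with the
   convexity of the squared residuals, gives with g = gamma/n, v_k = x_k - x_{k-1}
     E[d_{k+1}^2 + t2 |v_{k+1}|^2] <= (1+g) D_k - g D_{k-1} + c W_k - p F_k + q0 F_{k-1}
   where D_k = E d(x_k,P)^2, W_k = E |v_k|^2, F_k = 2 E f(x_k); the hypotheses amount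
   to g < 1, c < t2 and q0 < p.  Since the coefficient of D_{k-1} left after bounding
   F_{k-1} by mu2 D_{k-1} may be negative, the two-term recursion in D alone is
   not enough; instead D_k - g D_{k-1} + t2 W_k + q F_{k-1} with q0 < q < p
   contracts geometrically, and g < 1 transfers the rate to D_k + t2 W_k.  Hence
   the sum of the E |v_k| is finite, so that of the |v_k| is almost surely. *)

Require Import Defs.
From mathcomp Require Import all_boot all_order all_algebra all_fingroup.
From mathcomp Require Import all_classical all_reals all_analysis.
From mathcomp Require Import measurable_realfun ring lra.

Import Order.TTheory GRing.Theory Num.Theory.
Import numFieldNormedType.Exports.

Set Implicit Arguments.
Unset Strict Implicit.
Unset Printing Implicit Defensive.

Local Open Scope classical_set_scope.
Local Open Scope ring_scope.

(** * The Euclidean inner product on column vectors *)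

Section InnerProduct.
Context {R : realType}.

Definition dotv {n : nat} (u v : 'cV[R]_n) : R := \sum_(i < n) u i 0 * v i 0.

Context {n : nat}.
Implicit Types (u v w : 'cV[R]_n) (a : R).

Lemma dotvC u v : dotv u v = dotv v u.
Proof. by apply: eq_bigr => i _; rewrite mulrC. Qed.

Lemma dotvDl u v w : dotv (u + v) w = dotv u w + dotv v w.
Proof. by rewrite -big_split; apply: eq_bigr => i _; rewrite !mxE mulrDl. Qed.

Lemma dotvDr u v w : dotv u (v + w) = dotv u v + dotv u w.
Proof. by rewrite dotvC dotvDl !(dotvC u). Qed.

Lemma dotvZl a u v : dotv (a *: u) v = a * dotv u v.
Proof. by rewrite mulr_sumr; apply: eq_bigr => i _; rewrite !mxE mulrA. Qed.

Lemma dotvZr a u v : dotv u (a *: v) = a * dotv u v.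
Proof. by rewrite dotvC dotvZl dotvC. Qed.

Lemma dotvNl u v : dotv (- u) v = - dotv u v.
Proof. by rewrite -scaleN1r dotvZl mulN1r. Qed.

Lemma dotvNr u v : dotv u (- v) = - dotv u v.
Proof. by rewrite dotvC dotvNl dotvC. Qed.

Definition dotvE := (dotvDl, dotvDr, dotvZl, dotvZr, dotvNl, dotvNr).

Lemma dotvv_ge0 u : 0 <= dotv u u.
Proof. by apply: sumr_ge0 => i _; rewrite -expr2 sqr_ge0. Qed.

Lemma dotvv_eq0 u : dotv u u = 0 -> u = 0.
Proof.
move=> /eqP; rewrite psumr_eq0 => [|i _]; last by rewrite -expr2 sqr_ge0.
move=> /allP u0; apply/matrixP => i j; rewrite !mxE ord1.
by have := u0 i (mem_index_enum _); rewrite -expr2 sqrf_eq0 => /eqP.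
Qed.

Lemma enorm_sqr u : enorm u ^+ 2 = dotv u u.
Proof.
rewrite /enorm (_ : \sum_(i < n) _ = dotv u u); last exact: eq_bigr.
by rewrite sqr_sqrtr ?dotvv_ge0.
Qed.

Lemma enorm_ge0 u : 0 <= enorm u.
Proof. exact: sqrtr_ge0. Qed.

Lemma dotv_delta u (j : 'I_n) : dotv u (delta_mx j 0) = u j 0.
Proof.
rewrite /dotv (bigD1 j) //= big1 => [|i /negPf ij]; rewrite !mxE ?eqxx ?ij /=.
  by rewrite mulr1 addr0.
by rewrite mulr0.
Qed.

Lemma sqr_coord_le u (i : 'I_n) : u i 0 ^+ 2 <= dotv u u.
Proof.
rewrite /dotv (bigD1 i)//= -expr2 lerDl.
by apply: sumr_ge0 => j _; rewrite -expr2 sqr_ge0.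
Qed.

End InnerProduct.

(** * Quadratic forms and the largest eigenvalue of a symmetric matrix *)

Section QuadraticForms.
Context {R : realType}.

(** Discriminant argument: evaluate at the minimizer [- b / c]. If [c = 0] and [b] is nonzero, the
    chosen [t] gives the affine function the value -1. *)
Lemma sqr_le_of_quadratic_ge0 (a b c : R) : 0 <= c ->
  (forall t, 0 <= a + 2 * t * b + t ^+ 2 * c) -> b ^+ 2 <= a * c.
Proof.
move=> c_ge0 q; have [c0|c0] := eqVneq c 0.
  have [->|b0] := eqVneq b 0; first by rewrite c0 expr0n /= mulr0.
  have := q (- (a + 1) / (2 * b)); rewrite c0.
  have -> : a + 2 * (- (a + 1) / (2 * b)) * b + (- (a + 1) / (2 * b)) ^+ 2 * 0
    = -1 by field.
  by move=> h; exfalso; lra.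
have cgt0 : 0 < c by rewrite lt_neqAle eq_sym c0 c_ge0.
have := q (- b / c).
have -> : a + 2 * (- b / c) * b + (- b / c) ^+ 2 * c = (a * c - b ^+ 2) / c
  by field.
by rewrite pmulr_lge0 ?invr_gt0 // subr_ge0.
Qed.

Lemma cauchy_schwarz n (u v : 'cV[R]_n) :
  dotv u v ^+ 2 <= dotv u u * dotv v v.
Proof.
apply: sqr_le_of_quadratic_ge0 => [|t]; first exact: dotvv_ge0.
have := dotvv_ge0 (u + t *: v); rewrite !dotvE (dotvC v u).
by congr (_ <= _); ring.
Qed.


Lemma dotv_mulmx n p (M : 'M[R]_(n, p)) (u : 'cV[R]_p) (v : 'cV[R]_n) :
  dotv (M *m u) v = dotv u (M^T *m v).
Proof.
have dE k (y z : 'cV[R]_k) : dotv y z = (y^T *m z) 0 0.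
  by rewrite !mxE; apply: eq_bigr => i _; rewrite !mxE.
by rewrite !dE trmx_mul mulmxA.
Qed.

(** Cauchy-Schwarz row by row; [K] is the squared Frobenius norm of [M]. *)
Lemma mulmx_bounded n p (M : 'M[R]_(n, p)) :
  exists2 K : R, 0 <= K &
    forall y, dotv (M *m y) (M *m y) <= K * dotv y y.
Proof.
pose r i : 'cV[R]_p := (row i M)^T.
exists (\sum_i dotv (r i) (r i)) => [|y].
  by apply: sumr_ge0 => i _; exact: dotvv_ge0.
rewrite mulr_suml; apply: ler_sum => i _.
have -> : (M *m y) i 0 = dotv (r i) y.
  by rewrite !mxE; apply: eq_bigr => j _; rewrite !mxE.
by rewrite -expr2 cauchy_schwarz.
Qed.

(** Expanding [0 <= |M y - y|^2] bounds the form by [|M y|^2 + |y|^2]. *)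
Lemma quadratic_form_bounded n (M : 'M[R]_n) :
  exists2 K : R, 0 <= K & forall y, dotv (M *m y) y <= K * dotv y y.
Proof.
have [K K0 KM] := mulmx_bounded M; exists (K + 1) => [|y]; first lra.
have := dotvv_ge0 (M *m y - y); have := KM y; have := dotvv_ge0 y.
have := dotvv_ge0 (M *m y).
rewrite !dotvE (dotvC y); nra.
Qed.

(* By Cauchy-Schwarz for the semi-inner product of B,
   |By|^4 <= (By, y) (B By, By) <= K (By, y) |By|^2. *)
Lemma psd_unitmx_coercive n (B : 'M[R]_n) : B^T = B ->
  (forall y, 0 <= dotv (B *m y) y) -> B \in unitmx ->
  exists2 K : R, 0 < K & forall y, dotv y y <= K * dotv (B *m y) y.
Proof.
move=> Bsym Bpsd Bunit.
have [K K0 KB] := quadratic_form_bounded B.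
have [C C0 CB] := mulmx_bounded (invmx B).
(* [C] bounds the inverse of [B], so [|y|^2 <= C |B y|^2 <= C K (B y, y)]; the added 1 makes the
   constant positive. *)
exists (C * K + 1) => [|y]; first by have := mulr_ge0 C0 K0; lra.
pose w := B *m y.
have yw : dotv y y <= C * dotv w w by have := CB w; rewrite /w mulKmx.
have cs : dotv w w ^+ 2 <= dotv w y * dotv (B *m w) w.
  apply: sqr_le_of_quadratic_ge0 => // t.
  have := Bpsd (y + t *: w).
  rewrite mulmxDr -scalemxAr !dotvE -/w (dotv_mulmx B w y) Bsym -/w.
  by congr (_ <= _); ring.
have ww : dotv w w <= K * dotv w y.
  have [w0|w0] := eqVneq (dotv w w) 0.
    by rewrite w0 mulr_ge0 ?Bpsd.
  have wgt : 0 < dotv w w by rewrite lt_neqAle eq_sym w0 dotvv_ge0.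
  rewrite -(ler_pM2r wgt) -expr2; apply: le_trans cs _.
  by rewrite mulrAC mulrC ler_wpM2r ?KB// Bpsd.
have := ler_wpM2l C0 ww; have := Bpsd y; rewrite -/w; nra.
Qed.

(* The supremum s of the form on the unit sphere is an eigenvalue: otherwise
   s - M would be invertible, hence coercive, and s could be lowered. *)
Lemma quadratic_form_le_lambda_max n (M : 'M[R]_n) : M^T = M ->
  forall y, dotv (M *m y) y <= lambda_max M * dotv y y.
Proof.
move=> Msym; case: n => [|n] in M Msym *.
  by move=> y; rewrite /dotv !big_ord0 mulr0.
have [K K0 KM] := quadratic_form_bounded M.
pose S := [set dotv (M *m y) y | y in [set y | dotv y y = 1]].
have S0 : S !=set0.
  exists (dotv (M *m delta_mx 0 0) (delta_mx 0 0)), (delta_mx 0 0) => //=.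
  by rewrite dotv_delta mxE eqxx.
have Sub : has_ubound S.
  by exists K => _ [y /= y1 <-]; have := KM y; rewrite y1 mulr1.
have Ssup : has_sup S by [].
have qs y : dotv (M *m y) y <= sup S * dotv y y.
  have [y0|y0] := eqVneq (dotv y y) 0.
    by rewrite (dotvv_eq0 y0) mulmx0 /dotv !big1 ?mulr0// => i _; rewrite !mxE mulr0.
  have ygt : 0 < dotv y y by rewrite lt_neqAle eq_sym y0 dotvv_ge0.
  pose c := (Num.sqrt (dotv y y))^-1.
  have c2 : c * c = (dotv y y)^-1.
    by rewrite -expr2 exprVn sqr_sqrtr// ltW.
  have : dotv (M *m (c *: y)) (c *: y) <= sup S.
    apply: sup_upper_bound => //; exists (c *: y) => //=.
    by rewrite !dotvE mulrA c2 mulVf.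
  by rewrite -scalemxAr !dotvE mulrA c2 mulrC ler_pdivrMr.
pose B := (sup S)%:M - M.
have By y : B *m y = sup S *: y - M *m y by rewrite mulmxBl mul_scalar_mx.
have Bsym : B^T = B by rewrite /B linearB /= tr_scalar_mx Msym.
have Bpsd y : 0 <= dotv (B *m y) y by rewrite By !dotvE subr_ge0.
have Bsing : B \notin unitmx.
  apply/negP => Bu; have [C C0 CB] := psd_unitmx_coercive Bsym Bpsd Bu.
  (* Coercivity of [B] says that on the unit sphere the form of [M] stays below [sup S - C^-1]. *)
  have : sup S <= sup S - C^-1.
    apply: ge_sup => // _ [y /= y1 <-]; have := CB y.
    rewrite By !dotvE y1 mulr1 -ler_pdivrMl// mulr1; lra.
  have : 0 < C^-1 by rewrite invr_gt0.
  lra.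
have eigS : eigenvalue M (sup S).
  rewrite /eigenvalue /eigenspace kermx_eq0 row_free_unit.
  by rewrite -(opprB (sup S)%:M) -scaleN1r unitmxZ// unitrN unitr1.
(* Besides membership, this needs the set of eigenvalues to be bounded: [sup S] bounds it.
   Eigenvectors are rows here, and symmetry of [M] lets them be transposed. *)
have sl : sup S <= lambda_max M.
  apply: sup_upper_bound => //; split; first by exists (sup S).
  exists (sup S) => a /= /eigenvalueP[v va v0].
  have vv : 0 < dotv v^T v^T.
    rewrite lt_neqAle dotvv_ge0 andbT eq_sym; apply: contraNneq v0 => /dotvv_eq0 h.
    by rewrite -(trmxK v) h trmx0.
  have := qs v^T; rewrite -{1}Msym -trmx_mul va linearZ /= !dotvE.
  by rewrite ler_pM2r.
by move=> y; apply: le_trans (qs y) _; rewrite ler_wpM2r ?dotvv_ge0.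
Qed.

End QuadraticForms.

(** * Distance to a nonempty set *)

Section Distance.
Context {R : realType} {n : nat}.
Variable S : set 'cV[R]_n.
Hypothesis S0 : S !=set0.
Implicit Types x z : 'cV[R]_n.

Lemma edistance_has_inf x : has_inf [set enorm (x - z) | z in S].
Proof.
split; first by have [z Sz] := S0; exists (enorm (x - z)), z.
by exists 0 => _ [z _ <-]; exact: enorm_ge0.
Qed.

Lemma edistance_ge0 x : 0 <= edistance x S.
Proof.
apply: lb_le_inf; first by have [] := edistance_has_inf x.
by move=> _ [z _ <-]; exact: enorm_ge0.
Qed.

Lemma sqr_edistance_le x z : S z -> edistance x S ^+ 2 <= dotv (x - z) (x - z).
Proof.
move=> Sz; rewrite -enorm_sqr ler_pXn2r ?nnegrE ?edistance_ge0 ?enorm_ge0//.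
by apply: ge_inf; [have [] := edistance_has_inf x|exists z].
Qed.

(** Near-minimizers stand in for a projection onto [S]. As [h <= 1], [(D + h)^2 <= D^2 + h (2 D + 1)
    <= D^2 + e]. *)
Lemma sqr_edistance_approx x e : 0 < e ->
  exists2 z, S z & dotv (x - z) (x - z) <= edistance x S ^+ 2 + e.
Proof.
move=> e0; have d0 := edistance_ge0 x; set D := edistance x S in d0 *.
pose h := Num.min 1 (e / (2 * D + 1)).
have D1 : 0 < 2 * D + 1 by lra.
have h0 : 0 < h by rewrite lt_min ltr01 divr_gt0.
have h1 : h <= 1 by rewrite ge_min lexx.
have he : h * (2 * D + 1) <= e by rewrite -ler_pdivlMr// ge_min lexx orbT.
have [_ [z Sz <-]] := inf_adherent h0 (edistance_has_inf x).
rewrite -/(edistance x S) -/D => zD; exists z => //; rewrite -enorm_sqr.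
have := enorm_ge0 (x - z); nra.
Qed.

(** Apply the bound at near-minimizers and let the slack tend to 0. *)
Lemma le_scaled_sqr_edistance (a c : R) x : 0 <= c ->
  (forall z, S z -> a <= c * dotv (x - z) (x - z)) ->
  a <= c * edistance x S ^+ 2.
Proof.
move=> c0 h; apply/ler_addgt0Pr => e e0.
(* Dividing by [c + 1] instead of [c] covers [c = 0] as well. *)
have e1 : 0 < e / (c + 1) by rewrite divr_gt0//; lra.
have [z Sz zle] := sqr_edistance_approx x e1.
apply: le_trans (h _ Sz) _; apply: le_trans (ler_wpM2l c0 zle) _.
rewrite mulrDr lerD2l mulrCA ger_pMr// ler_pdivrMr; lra.
Qed.

End Distance.

(** * Averages over the samples of a fixed size *)

Section UniformSamples.
Context {R : realType} {m beta : nat}.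
Hypotheses (beta_gt0 : (0 < beta)%N) (beta_le_m : (beta <= m)%N).

Lemma samples_gt0 : (0 < #|samples m beta|)%N.
Proof. by rewrite card_draws card_ord bin_gt0. Qed.

(** The transposition of [k] and [l] acts on samples as an involution and exchanges the two
    families. *)
Lemma card_samples_containing (k l : 'I_m) :
  #|[set tau in samples m beta | k \in tau]%SET| =
  #|[set tau in samples m beta | l \in tau]%SET|.
Proof.
pose s := tperm k l; pose h (t : {set 'I_m}) := (s @: t)%SET.
have hK : involutive h.
  move=> t; rewrite /h -imset_comp -[RHS]imset_id; apply: eq_imset => i /=.
  exact: tpermK.
rewrite -(card_imset _ (inv_inj hK)); apply: eq_card => t.
rewrite (can2_imset_pre _ hK hK) !inE card_imset; last exact: perm_inj.
congr (_ && _); rewrite -{1}(tpermR k l); apply: mem_imset; exact: perm_inj.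
Qed.

(** Double counting: every index lies in the same number [K] of samples, so its inclusion
    probability is [beta / m]. *)
Lemma sum_samples (c : 'I_m -> R) :
  #|samples m beta|%:R^-1 * \sum_(tau in samples m beta) \sum_(i in tau) c i
  = beta%:R / m%:R * \sum_i c i.
Proof.
have m0 : (0 < m)%N by apply: leq_trans beta_le_m.
have mR : m%:R != 0 :> R by rewrite pnatr_eq0 -lt0n.
have NR : #|samples m beta|%:R != 0 :> R by rewrite pnatr_eq0 -lt0n samples_gt0.
pose K := #|[set tau in samples m beta | Ordinal m0 \in tau]%SET|.
have dc (e : 'I_m -> R) : \sum_(tau in samples m beta) \sum_(i in tau) e i
    = K%:R * \sum_i e i.
  under eq_bigr do rewrite big_mkcond.
  rewrite exchange_big /= mulr_sumr; apply: eq_bigr => i _.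
  rewrite -big_mkcondr /= sumr_const mulr_natl; congr (_ *+ _).
  rewrite /K (card_samples_containing _ i); apply: eq_card => t.
  by rewrite [RHS]inE unfold_in.
(* The constant weight 1 determines [K]: both ways of counting give [K m = N beta], with [N] the
   number of samples. *)
have : \sum_(tau in samples m beta) \sum_(i in tau) 1 = K%:R * m%:R :> R.
  by rewrite dc sumr_const card_ord.
rewrite (eq_bigr (fun=> beta%:R)); last first.
  by move=> t; rewrite inE => /eqP tb; rewrite sumr_const tb.
rewrite sumr_const -[LHS]mulr_natl => NK.
rewrite dc mulrA; congr (_ * _).
have -> : K%:R = #|samples m beta|%:R * beta%:R / m%:R :> R by rewrite NK mulfK.
by field; rewrite mR NR.
Qed.

Lemma mean_samples_cst (c : R) :
  #|samples m beta|%:R^-1 * \sum_(tau in samples m beta) c = c.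
Proof.
rewrite sumr_const -[X in _ * X]mulr_natl mulKf// pnatr_eq0 -lt0n; exact: samples_gt0.
Qed.

Lemma mean_samples_affine (a p q : R) (F G : {set 'I_m} -> R) :
  #|samples m beta|%:R^-1 *
    \sum_(tau in samples m beta) (a - p * F tau + q * G tau) =
  a - p * (#|samples m beta|%:R^-1 * \sum_(tau in samples m beta) F tau)
    + q * (#|samples m beta|%:R^-1 * \sum_(tau in samples m beta) G tau).
Proof.
rewrite big_split sumrB -!mulr_sumr mulrDr mulrBr mean_samples_cst.
by rewrite ![in LHS](mulrCA _^-1).
Qed.

Lemma le_mean_samples (F G : {set 'I_m} -> R) :
  (forall tau, tau \in samples m beta -> F tau <= G tau) ->
  #|samples m beta|%:R^-1 * \sum_(tau in samples m beta) F tau <=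
  #|samples m beta|%:R^-1 * \sum_(tau in samples m beta) G tau.
Proof. by move=> FG; rewrite ler_wpM2l ?invr_ge0 ?ler0n// ler_sum. Qed.

End UniformSamples.

(** * Residuals of the constraints and feasible points *)

Section Feasibility.
Context {R : realType} {m n : nat}.
Variables (A : 'M[R]_(m, n)) (b : 'cV[R]_m).
Hypothesis unit_rows : forall i, enorm (arow A i) = 1.
Implicit Types x y z : 'cV[R]_n.

Definition max_residual (tau : {set 'I_m}) x : R :=
  \big[Num.max/0]_(i in tau) residual A b x i.

Lemma mulmx_arow x i : (A *m x) i 0 = dotv (arow A i) x.
Proof. by rewrite !mxE; apply: eq_bigr => j _; rewrite !mxE. Qed.

Lemma residualE x i : residual A b x i = Num.max (dotv (arow A i) x - b i 0) 0.
Proof. by rewrite /residual -mulmx_arow !mxE. Qed.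

Lemma residual_ge0 x i : 0 <= residual A b x i.
Proof. by rewrite residualE le_max lexx orbT. Qed.

Lemma dotv_arow i : dotv (arow A i) (arow A i) = 1.
Proof. by rewrite -enorm_sqr unit_rows expr1n. Qed.

Lemma max_residual_ge0 tau x : 0 <= max_residual tau x.
Proof. exact: bigmax_ge_id. Qed.

Lemma residual_le_max (tau : {set 'I_m}) x i :
  i \in tau -> residual A b x i <= max_residual tau x.
Proof. by move=> it; apply: le_bigmax_cond. Qed.

Lemma sqr_max_residual_le (tau : {set 'I_m}) x (c : R) : 0 <= c ->
  (forall i, i \in tau -> residual A b x i ^+ 2 <= c) ->
  max_residual tau x ^+ 2 <= c.
Proof.
move=> c0 h; rewrite -(sqr_sqrtr c0) ler_pXn2r ?nnegrE ?sqrtr_ge0 ?max_residual_ge0//.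
apply: bigmax_le => [|i it]; first exact: sqrtr_ge0.
by rewrite -[leLHS]ger0_norm ?residual_ge0// -sqrtr_sqr ler_wsqrtr// h.
Qed.

(** Feasibility gives [a_i^T z <= b_i], so a positive residual is at most [a_i^T (x - z)]. *)
Lemma residual_le_dotv x z i : polyhedron A b z ->
  residual A b x i ^+ 2 <= dotv (arow A i) (x - z) ^+ 2.
Proof.
move=> /(_ i); rewrite mulmx_arow => zi.
rewrite residualE dotvDr dotvNr; case: (leP (_ - b i 0) 0) => h.
  by rewrite expr0n sqr_ge0.
nra.
Qed.

(** The same comparison multiplied by the residual; it provides the descent term of a step relative
    to [z]. *)
Lemma residual_mul_dotv_ge x z i : polyhedron A b z ->
  residual A b x i ^+ 2 <= residual A b x i * dotv (arow A i) (x - z).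
Proof.
move=> /(_ i); rewrite mulmx_arow => zi.
by rewrite residualE dotvDr dotvNr; case: (leP (_ - b i 0) 0) => h; nra.
Qed.

(* The tangent at x lies below the convex function [y |-> residual y i ^+ 2]. *)
Lemma residual_sqr_convex x y i :
  residual A b x i ^+ 2 - 2 * residual A b x i * dotv (arow A i) (x - y)
    <= residual A b y i ^+ 2.
Proof.
rewrite !residualE dotvDr dotvNr.
set u := dotv _ x; set v := dotv _ y; set c := b i 0.
have : 0 <= ((u - c) - (v - c)) ^+ 2 by exact: sqr_ge0.
have [h|h] := leP (u - c) 0; have [h'|h'] := leP (v - c) 0; nra.
Qed.

End Feasibility.

(** * Bounds on the objective by the squared distance to the polyhedron *)

Section SampledObjective.
Context {R : realType} {m n : nat}.
Variables (A : 'M[R]_(m, n)) (b : 'cV[R]_m) (beta : nat) (L : R).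
Hypothesis unit_rows : forall i, enorm (arow A i) = 1.
Hypothesis feasible : polyhedron A b !=set0.
Hypotheses (beta_gt0 : (0 < beta)%N) (beta_le_m : (beta <= m)%N).
Hypothesis hoffman : hoffman_constant A b L.
Implicit Types x y z : 'cV[R]_n.

Let mR : 0 < m%:R :> R. Proof. by rewrite ltr0n (leq_trans beta_gt0). Qed.
Let betaR : 0 < beta%:R :> R. Proof. by rewrite ltr0n. Qed.

Lemma sskm_fE x : 2 * sskm_f A b beta x =
  #|samples m beta|%:R^-1 *
    \sum_(tau in samples m beta) max_residual A b tau x ^+ 2.
Proof. by rewrite /sskm_f mulVKf. Qed.

Lemma sskm_f_ge0 x : 0 <= sskm_f A b beta x.
Proof.
rewrite !mulr_ge0 ?invr_ge0 ?ler0n// sumr_ge0// => tau _; exact: sqr_ge0.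
Qed.

Lemma mu1_gt0 : 0 < mu1 m L.
Proof. by case: hoffman => L0 _; rewrite invr_gt0 mulr_gt0 ?exprn_gt0. Qed.

(** The squared maximum over a sample is at least the mean of the squares over it; averaging over
    samples leaves [|(A x - b)^+|^2 / m], to which the Hoffman bound applies. *)
Lemma sskm_f_ge x :
  mu1 m L * edistance x (polyhedron A b) ^+ 2 <= 2 * sskm_f A b beta x.
Proof.
case: hoffman => L0 /(_ x); set D := _ ^+ 2; rewrite enorm_sqr => DL.
have : #|samples m beta|%:R^-1 * (\sum_(tau in samples m beta)
    \sum_(i in tau) beta%:R^-1 * residual A b x i ^+ 2) <= 2 * sskm_f A b beta x.
  rewrite sskm_fE; apply: le_mean_samples => tau; rewrite inE => /eqP tb.
  rewrite -mulr_sumr ler_pdivrMl// -[in leRHS]tb mulr_natl -sumr_const.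
  apply: ler_sum => i it.
  rewrite ler_pXn2r ?nnegrE ?residual_ge0 ?max_residual_ge0//.
  exact: residual_le_max.
apply: le_trans; rewrite sum_samples// -mulr_sumr.
have -> : \sum_i residual A b x i ^+ 2 =
    dotv (pos_part (A *m x - b)) (pos_part (A *m x - b)).
  by apply: eq_bigr => i _; rewrite -expr2.
have -> (t : R) : beta%:R / m%:R * (beta%:R^-1 * t) = m%:R^-1 * t.
  by field; rewrite !gt_eqF.
rewrite /mu1 invfM -mulrA ler_pM2l ?invr_gt0//.
by rewrite ler_pdivrMl ?exprn_gt0.
Qed.

(** Rows have norm 1, so Cauchy-Schwarz bounds each residual by [|x - z|]. This is the branch of
    [mu2] equal to 1. *)
Lemma sskm_f_le_edistance x :
  2 * sskm_f A b beta x <= edistance x (polyhedron A b) ^+ 2.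
Proof.
rewrite -[leRHS]mul1r; apply: le_scaled_sqr_edistance => // z Pz; rewrite mul1r.
rewrite sskm_fE -[leRHS](mean_samples_cst beta_le_m).
apply: le_mean_samples => tau _.
apply: sqr_max_residual_le => [|i _]; first exact: dotvv_ge0.
apply: le_trans (residual_le_dotv _ _ Pz) _.
by have := cauchy_schwarz (arow A i) (x - z); rewrite dotv_arow// mul1r.
Qed.

(** Bounding the maximum over a sample by the sum, then averaging, gives [beta / m] times
    [|A (x - z)|^2], a quadratic form of [A^T A]. *)
Lemma sskm_f_le_lambda_max x z : polyhedron A b z ->
  2 * sskm_f A b beta x <=
    beta%:R / m%:R * lambda_max (A^T *m A) * dotv (x - z) (x - z).
Proof.
move=> Pz; apply: (@le_trans _ _
    (beta%:R / m%:R * \sum_i dotv (arow A i) (x - z) ^+ 2)).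
  rewrite -sum_samples// sskm_fE; apply: le_mean_samples => tau _.
  apply: sqr_max_residual_le => [|i it]; first by apply: sumr_ge0 => *; exact: sqr_ge0.
  apply: le_trans (residual_le_dotv _ _ Pz) _.
  by rewrite (bigD1 i)//= lerDl sumr_ge0// => *; exact: sqr_ge0.
rewrite -[leRHS]mulrA ler_pM2l ?divr_gt0//.
rewrite (_ : \sum_i _ = dotv (A *m (x - z)) (A *m (x - z))); last first.
  by apply: eq_bigr => i _; rewrite mulmx_arow expr2.
rewrite dotv_mulmx dotvC mulmxA; apply: quadratic_form_le_lambda_max.
by rewrite trmx_mul trmxK.
Qed.

(** The point on the line of [a_i] with [a_i^T x = b_i + 1] is at distance at least 1, by
    Cauchy-Schwarz. It fixes the sign of the eigenvalue bound and allows division by a positive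
    distance. *)
Lemma infeasible_point : exists x, 0 < edistance x (polyhedron A b).
Proof.
have m0 : (0 < m)%N by rewrite (leq_trans beta_gt0).
pose i := Ordinal m0.
pose x := (b i 0 + 1) *: arow A i; exists x.
suff : 1 <= 1 * edistance x (polyhedron A b) ^+ 2.
  rewrite mul1r => h; rewrite lt_neqAle edistance_ge0// andbT.
  by apply: contraTneq h => <-; rewrite expr0n /= -ltNge.
apply: le_scaled_sqr_edistance => // z Pz; rewrite mul1r.
have := cauchy_schwarz (arow A i) (x - z); rewrite dotv_arow// mul1r.
apply: le_trans; have := Pz i; rewrite mulmx_arow => zi.
rewrite dotvDr dotvNr /x dotvZr dotv_arow//; nra.
Qed.

Lemma sskm_f_le x :
  2 * sskm_f A b beta x <= mu2 A beta * edistance x (polyhedron A b) ^+ 2.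
Proof.
have [y y0] := infeasible_point.
(* Passing to the infimum over [z] needs a nonnegative coefficient. At the infeasible point it
   multiplies a positive number and bounds the nonnegative objective. *)
have l0 : 0 <= beta%:R / m%:R * lambda_max (A^T *m A).
  have [z Pz] := feasible.
  have yz := lt_le_trans (exprn_gt0 2 y0) (sqr_edistance_le feasible y Pz).
  rewrite -(pmulr_lge0 _ yz) (le_trans _ (sskm_f_le_lambda_max y Pz))//.
  by rewrite mulr_ge0 ?sskm_f_ge0.
rewrite /mu2; case: (leP 1 (_ * _)) => _; first by rewrite mul1r sskm_f_le_edistance.
by apply: le_scaled_sqr_edistance => // z; exact: sskm_f_le_lambda_max.
Qed.

(** Compare the lower and upper bounds of the objective at an infeasible point. *)
Lemma mu1_le_mu2 : mu1 m L <= mu2 A beta.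
Proof.
have [y y0] := infeasible_point.
rewrite -(ler_pM2r (exprn_gt0 2 y0)); apply: le_trans (sskm_f_ge y) _.
exact: sskm_f_le.
Qed.

End SampledObjective.

(** * Expected effect of one step, given the sample *)

Section OneStep.
Context {R : realType} {m n : nat}.
Variables (A : 'M[R]_(m, n)) (b : 'cV[R]_m).
Hypothesis unit_rows : forall i, enorm (arow A i) = 1.
Hypothesis n_gt0 : (0 < n)%N.

(** A random coordinate of [v] is [v / n] on average, whence the factor [1 / n] on both the cross
    term and the square. *)
Lemma mean_coordinate_step (u v : 'cV[R]_n) (c : R) :
  n%:R^-1 * \sum_j dotv (u + (c * v j 0) *: delta_mx j 0)
                        (u + (c * v j 0) *: delta_mx j 0) =
  dotv u u + 2 * (c / n%:R) * dotv v u + c ^+ 2 / n%:R * dotv v v.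
Proof.
rewrite (eq_bigr (fun j => dotv u u + (2 * c) * (v j 0 * u j 0)
   + c ^+ 2 * (v j 0 * v j 0))); last first.
  move=> j _; rewrite !dotvE (dotvC (delta_mx j 0) u) !dotv_delta mxE !eqxx /=.
  by ring.
rewrite !big_split /= sumr_const card_ord -!mulr_sumr -!/(dotv _ _) -mulr_natl.
by field; rewrite pnatr_eq0 -lt0n.
Qed.

Variables (delta gamma t : R).
Hypotheses (delta_gt0 : 0 < delta) (gamma_ge0 : 0 <= gamma) (t_ge0 : 0 <= t).

Definition sskm_next (x y : 'cV[R]_n) (i : 'I_m) (j : 'I_n) : 'cV[R]_n :=
  x - (delta * residual A b x i) *: arow A i
    + (gamma * (x - y) j 0) *: delta_mx j 0.

(** Here [x] is the current iterate and [y] the previous one. The cross term of [x - z] with [x - y]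
    is traded for the squared distances of [x] and [y] to [z]; that of [a_i] with [x - y] is
    controlled by convexity of the squared residual. *)
Lemma mean_sskm_next_le (x y z : 'cV[R]_n) (tau : {set 'I_m}) (i : 'I_m) :
  polyhedron A b z -> i \in tau ->
  (forall l, l \in tau -> residual A b x l <= residual A b x i) ->
  let g := gamma / n%:R in
  n%:R^-1 * \sum_j (dotv (sskm_next x y i j - z) (sskm_next x y i j - z)
                 + t * dotv (sskm_next x y i j - x) (sskm_next x y i j - x))
  <= (1 + g) * dotv (x - z) (x - z) - g * dotv (y - z) (y - z)
     + (gamma + gamma ^+ 2 * (1 + t)) / n%:R * dotv (x - y) (x - y)
     - (2 * delta - delta ^+ 2 * (1 + t) + (1 + t) * g * delta)
       * max_residual A b tau x ^+ 2
     + (1 + t) * g * delta * max_residual A b tau y ^+ 2.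
Proof.
move=> Pz it imax; set g := gamma / n%:R; cbv zeta.
have -> : max_residual A b tau x = residual A b x i.
  apply/eqP; rewrite eq_le residual_le_max// andbT.
  by apply: bigmax_le => //; exact: residual_ge0.
set r := residual A b x i; set a := arow A i.
set u := x - (delta * r) *: a - z; set u' := - ((delta * r) *: a).
rewrite (eq_bigr (fun j =>
  dotv (u + (gamma * (x - y) j 0) *: delta_mx j 0)
       (u + (gamma * (x - y) j 0) *: delta_mx j 0)
  + t * dotv (u' + (gamma * (x - y) j 0) *: delta_mx j 0)
             (u' + (gamma * (x - y) j 0) *: delta_mx j 0))); last first.
  move=> j _; rewrite /sskm_next -/r -/a.
  set e := _ *: delta_mx j 0; set w := _ *: a.
  have -> : x - w + e - z = u + e by rewrite /u -/w addrAC.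
  by have -> : x - w + e - x = u' + e by rewrite /u' -/w addrC !addrA addNr add0r.
rewrite big_split /= -mulr_sumr mulrDr mulrCA !mean_coordinate_step.
have rz := residual_mul_dotv_ge x i Pz; rewrite -/r -/a in rz.
(* Row [i] is selected for [x]; at [y] its residual is only one among those of the same sample,
   hence the maximum on the right. *)
have ry : r ^+ 2 - 2 * r * dotv a (x - y) <= max_residual A b tau y ^+ 2.
  apply: le_trans (residual_sqr_convex A b x y i) _.
  rewrite ler_pXn2r ?nnegrE ?residual_ge0 ?max_residual_ge0//.
  exact: residual_le_max.
set M := max_residual A b tau y in ry *.
have aa : dotv a a = 1 by rewrite dotv_arow.
have -> : y - z = (x - z) - (x - y) by rewrite opprB [RHS]addrC addrA subrK.
have {u} -> : u = x - z - (delta * r) *: a by rewrite /u addrAC.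
move: (x - z) (x - y) rz ry => w v rz ry.
rewrite {}/u' !dotvE aa (dotvC w a) (dotvC w v) (dotvC v a).
have g0 : 0 <= g by rewrite divr_ge0.
have -> : gamma ^+ 2 / n%:R = g * gamma by rewrite /g; ring.
have -> : (gamma + gamma ^+ 2 * (1 + t)) / n%:R = g * (1 + gamma * (1 + t)).
  by rewrite /g; ring.
have -> : gamma / n%:R = g by [].
have h1 := ler_wpM2l (ltW delta_gt0) rz.
have gd : 0 <= (1 + t) * g * delta by rewrite !mulr_ge0// ?addr_ge0// ltW.
have h2 := ler_wpM2l gd ry.
rewrite -subr_ge0 in h1; rewrite -subr_ge0 in h2; rewrite -subr_ge0.
(* [h1] enters twice for the factor 2 of the cross term in the expanded square. *)
move: (addr_ge0 (addr_ge0 h1 h1) h2); congr (_ <= _); ring.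
Qed.

End OneStep.

(** * Geometric decay of the two-term recursion *)

Section Recursion.
Context {R : realType}.

(* The Lyapunov function D_{k+1} - g D_k + t W_{k+1} + q F_k contracts although
   it may be negative; it controls D_{k+1} + t W_{k+1} up to g D_k. *)
Lemma momentum_recursion_rate (t g c p q0 mu : R) :
  0 < t -> 0 <= g < 1 -> c < t -> 0 <= q0 < p -> 0 < mu ->
  exists K s : R, [/\ 0 <= K, 0 < s, s < 1 &
    forall D W F : nat -> R,
    (forall k, 0 <= W k) ->
    (forall k, 0 <= D k) ->
    (forall k, mu * D k <= F k <= D k) -> D 1%N = D 0%N -> W 1%N = 0 ->
    (forall k, D k.+2 + t * W k.+2 <= (1 + g) * D k.+1 - g * D k
       + c * W k.+1 - p * F k.+1 + q0 * F k) ->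
    forall k, D k.+1 + t * W k.+1 <= s ^+ k * (1 + K) * D 0%N].
Proof.
move=> t0 /andP[g0 g1] ct /andP[q00 q0p] mu0.
(* The midpoint leaves the same gap [sl] on both sides: [p - q = q - q0 = sl]. *)
pose q := (p + q0) / 2; pose sl := (p - q0) / 2.
have q_gt0 : 0 < q by rewrite /q; lra.
have sl0 : 0 < sl by rewrite /sl; lra.
(* The first three terms give the decay of the [D], [W] and [F] parts of the Lyapunov function; the
   last keeps [1 - e] positive. *)
pose e := Num.min (Num.min (sl * mu) ((t - c) / t))
                  (Num.min (sl / q) (2^-1)).
have e0 : 0 < e.
  rewrite !lt_min mulr_gt0// !divr_gt0 ?subr_gt0//=; lra.
have e1 : e <= sl * mu by rewrite !ge_min lexx.
have e2 : e * t <= t - c by rewrite -ler_pdivlMr// !ge_min lexx orbT.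
have e3 : e * q <= sl by rewrite -ler_pdivlMr// !ge_min lexx !orbT.
have e4 : e <= 2^-1 by rewrite !ge_min lexx !orbT.
(* The rate must exceed both the contraction factor [1 - e] and [g], the latter strictly since
   [s - g] is a denominator below. *)
pose s := (Num.max (1 - e) g + 1) / 2.
have se : 1 - e < s.
  have : 1 - e <= Num.max (1 - e) g by rewrite le_max lexx.
  have : Num.max (1 - e) g < 1 by rewrite gt_max g1 andbT; lra.
  rewrite /s; lra.
have [sg s1] : g < s /\ s < 1.
  have : g <= Num.max (1 - e) g by rewrite le_max lexx orbT.
  have : Num.max (1 - e) g < 1 by rewrite gt_max g1 andbT; lra.
  by rewrite /s => *; split; lra.
have s0 : 0 < s by lra.
have sg0 : 0 < s - g by lra.
(* Chosen so that [(1 + q) s + g (1 + K) <= s (1 + K)], which closes the final induction. *)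
pose K := (1 + q) * s / (s - g).
have K0 : 0 <= K by apply: divr_ge0; [apply: mulr_ge0|]; lra.
have Kg : K * (s - g) = (1 + q) * s by rewrite /K divfK ?gt_eqF.
exists K, s; split => // D W F W0 D0 muF D1 W1 rec.
have F0 k : 0 <= F k.
  by have /andP[+ _] := muF k; apply: le_trans; rewrite mulr_ge0// ltW.
pose V k := D k.+1 - g * D k + t * W k.+1 + q * F k.
have VE k : V k.+1 <= (1 - e) * V k.
  have := rec k; rewrite /V; have /andP[f1 _] := muF k.+1.
  have h1 := ler_wpM2r (D0 k.+1) e1; have h2 := ler_wpM2r (W0 k.+1) e2.
  have h3 := ler_wpM2r (F0 k) e3.
  have h4 := ler_wpM2l (ltW sl0) f1.
  have h5 : 0 <= e * (g * D k) by rewrite !mulr_ge0// ltW.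
  have -> : q = q0 + sl by rewrite /q /sl; lra.
  have -> : p = q0 + 2 * sl by rewrite /sl; lra.
  move: h3; have -> : q = q0 + sl by rewrite /q /sl; lra.
  move=> h3 h6; have := F0 k.+1; lra.
have V0 : V 0%N <= (1 + q) * D 0%N.
  rewrite /V D1 W1; have /andP[_ f2] := muF 0%N.
  have := ler_wpM2l (ltW q_gt0) f2; have := mulr_ge0 g0 (D0 0%N); lra.
have e_1 : 0 <= 1 - e by lra.
have Vk k : V k <= s ^+ k * ((1 + q) * D 0%N).
  have : V k <= (1 - e) ^+ k * ((1 + q) * D 0%N).
    elim: k => [|k IH]; first by rewrite mul1r.
    by apply: le_trans (VE k) _; rewrite exprS -mulrA ler_wpM2l.
  move=> /le_trans; apply; rewrite ler_wpM2r//; first by rewrite mulr_ge0//; lra.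
  by rewrite lerXn2r ?nnegrE// ltW.
elim=> [|k IH].
  rewrite mul1r D1 W1 mulr0 addr0 mulrDl mul1r lerDl; exact: mulr_ge0.
have : D k.+2 + t * W k.+2 <= V k.+1 + g * D k.+1.
  by rewrite /V; have := mulr_ge0 (ltW q_gt0) (F0 k.+1); lra.
move=> /le_trans; apply.
have := Vk k.+1; have : D k.+1 <= s ^+ k * (1 + K) * D 0%N.
  by apply: le_trans IH; rewrite lerDl mulr_ge0// ltW.
move=> /(ler_wpM2l g0); rewrite exprS.
have : 0 <= (s - g) * (s ^+ k * D 0%N).
  by rewrite !mulr_ge0 ?exprn_ge0// ltW.
have -> : s * s ^+ k * ((1 + q) * D 0%N) = K * (s - g) * (s ^+ k * D 0%N).
  by rewrite Kg; ring.
set X := s ^+ k * D 0%N => Xg.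
have -> : s ^+ k * (1 + K) * D 0%N = (1 + K) * X by rewrite /X; ring.
have -> : s * s ^+ k * (1 + K) * D 0%N = s * (1 + K) * X by rewrite /X; ring.
by lra.
Qed.

End Recursion.

(** * Measurability of finite-valued random elements *)

Section RandomElements.
Context {d : measure_display} {T : measurableType d}.

Lemma random_element_point (S : finType) (X : T -> S) :
  (forall s, measurable (X @^-1` [set s])) -> random_element X.
Proof.
move=> mX B.
rewrite (_ : X @^-1` B = \bigcup_(s in B) X @^-1` [set s]); last first.
  apply/seteqP; split => [w Bw|w [s Bs /= Xw]]; first by exists (X w).
  by rewrite /= Xw.
by apply: fin_bigcup_measurable => [|s _]; [exact: finite_finset|exact: mX].
Qed.

Lemma random_element_comp (S U : finType) (X : T -> S) (h : S -> U) :
  random_element X -> random_element (h \o X).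
Proof. by move=> rX B; rewrite comp_preimage; exact: rX. Qed.

Lemma random_element_pair (S U : finType) (X : T -> S) (Y : T -> U) :
  random_element X -> random_element Y -> random_element (fun w => (X w, Y w)).
Proof.
move=> rX rY; apply: random_element_point => -[s u].
rewrite (_ : _ @^-1` _ = X @^-1` [set s] `&` Y @^-1` [set u]).
  exact: measurableI.
by apply/seteqP; split => w /= [-> ->].
Qed.

End RandomElements.

(** * Expectations as finite sums over the law of a random element *)

Section FiniteMean.
Context {d : measure_display} {T : measurableType d} {R : realType}.
Variable P : probability T R.

Definition law {S : finType} (X : T -> S) (s : S) : R := fine (P (X @^-1` [set s])).

Definition mean {S : finType} (X : T -> S) (g : S -> R) : R :=
  \sum_s law X s * g s.

Section OneElement.
Context {S : finType}.
Variable X : T -> S.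
Hypothesis rX : random_element X.
Implicit Types f g : S -> R.

(** Write [g (X w)] as a combination of the indicators of the fibres of [X]. *)
Lemma expectation_mean g : ('E_P[fun w => g (X w)] = (mean X g)%:E)%E.
Proof.
have iX s : P.-integrable setT (EFin \o \1_(X @^-1` [set s])).
  by apply: integrable_indic => //; rewrite ltey_eq fin_num_measure.
rewrite unlock.
rewrite (_ : (fun w => (g (X w))%:E) = (fun w => \sum_(s : S)
  ((g s)%:E * (EFin \o \1_(X @^-1` [set s])) w)))%E; last first.
  apply/funext => w; rewrite (bigD1 (X w))//= big1 => [|s sX]; last first.
    rewrite indicE memNset ?mule0//= => /esym/eqP.
    exact/negP.
  by rewrite indicE mem_set// mule1 adde0.
rewrite integral_sum//; last by move=> s; exact: integrableZl.
rewrite /mean -sumEFin; apply: eq_bigr => s _.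
rewrite integralZl// integral_indic// setIT EFinM muleC /law fineK//.
exact: fin_num_measure.
Qed.

Lemma law_ge0 s : 0 <= law X s.
Proof. exact: fine_ge0. Qed.

Lemma mean_cst c : mean X (fun=> c) = c.
Proof. by apply: EFin_inj; rewrite -expectation_mean expectation_cst. Qed.

Lemma meanD f g : mean X (fun s => f s + g s) = mean X f + mean X g.
Proof. by rewrite -big_split; apply: eq_bigr => s _; rewrite mulrDr. Qed.

Lemma meanZ c g : mean X (fun s => c * g s) = c * mean X g.
Proof. by rewrite mulr_sumr; apply: eq_bigr => s _; rewrite mulrCA. Qed.

(** Comparing on attained values suffices, because the others have law 0. *)
Lemma le_mean f g : (forall w, f (X w) <= g (X w)) -> mean X f <= mean X g.
Proof.
move=> fg; apply: ler_sum => s _.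
have [[w <-]|nX] := pselect (exists w, X w = s).
  by rewrite ler_wpM2l// law_ge0.
rewrite /law (_ : X @^-1` _ = set0) ?measure0 ?mul0r//.
by apply/seteqP; split => // w Xw; apply: nX; exists w.
Qed.

Lemma eq_mean f g : (forall w, f (X w) = g (X w)) -> mean X f = mean X g.
Proof. by move=> fg; apply/eqP; rewrite eq_le !le_mean// => w; rewrite fg. Qed.

End OneElement.

Lemma mean_comp (S U : finType) (X : T -> S) (h : S -> U) (g : U -> R) :
  random_element X -> mean (h \o X) g = mean X (g \o h).
Proof.
move=> rX; apply: EFin_inj.
by rewrite -(expectation_mean (random_element_comp h rX)) -expectation_mean.
Qed.

(** Fubini for a finite product: the joint law is the law of [X] times the uniform weight on [D].
    This replaces conditional expectation. *)
Lemma mean_uniform_indep (S U : finType) (D : {set U}) (X : T -> S) (Y : T -> U)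
    (F : S -> U -> R) :
  random_element X -> random_element Y ->
  uniform_on P D Y -> independent_elements P Y X ->
  mean (fun w => (X w, Y w)) (fun su => F su.1 su.2) =
  mean X (fun s => #|D|%:R^-1 * \sum_(u in D) F s u).
Proof.
move=> rX rY [YD unifY] indep.
have lawE s u : law (fun w => (X w, Y w)) (s, u) =
    law X s * (if u \in D then #|D|%:R^-1 else 0).
  rewrite /law (_ : _ @^-1` _ = Y @^-1` [set u] `&` X @^-1` [set s]); last first.
    by apply/seteqP; split => w /= [-> ->].
  rewrite indep fineM ?fin_num_measure// mulrC; congr (_ * _).
  case: ifPn => [uD|uD]; first by rewrite unifY.
  rewrite (_ : _ @^-1` _ = set0) ?measure0//; apply/seteqP; split => // w /= Yu.
  by move: uD; rewrite -Yu YD.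
rewrite /mean; transitivity (\sum_s \sum_u law (fun w => (X w, Y w)) (s, u) * F s u).
  by rewrite pair_bigA; apply: eq_bigr => -[].
apply: eq_bigr => s _; rewrite !mulr_sumr [RHS]big_mkcond /=.
by apply: eq_bigr => u _; rewrite lawE; case: ifP => _; rewrite ?mulrA// mulr0 mul0r.
Qed.

End FiniteMean.

(** * Convergence from summable increments *)

Section SummableIncrements.
Context {R : realType}.

(** The telescoping series converges absolutely. *)
Lemma cvg_bounded_variation (u : nat -> R) (M : R) :
  (forall N, \sum_(0 <= k < N) `|u k.+1 - u k| <= M) -> cvgn u.
Proof.
move=> uM.
have cs : cvgn (series (telescope u)).
  apply: normed_cvg; apply: nondecreasing_is_cvgn.
    by apply: nondecreasing_series => k _ _; exact: normr_ge0.
  by exists M => _ [N _ <-]; exact: uM.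
rewrite (_ : u = fun N => u 0%N + series (telescope u) N).
  by apply: is_cvgD => //; exact: is_cvg_cst.
by apply/funext => N; rewrite -eq_sum_telescope.
Qed.

Lemma cvg_coordinates n (u : nat -> 'cV[R]_n) :
  (forall i, cvgn (fun k => u k i 0)) -> cvgn u.
Proof.
move=> cu; apply/cvg_ex; exists (\col_i limn (fun k => u k i 0)).
apply/cvg_mx_entourageP => E entE; rewrite !near_simpl /=.
have uE i : \forall k \near \oo, E (limn (fun k => u k i 0), u k i 0).
  by have := cu i; move/cvg_entourageP; apply.
near=> k => i j; rewrite mxE ord1 inE.
by move: i; near: k; exact: filter_forall.
Unshelve. all: by end_near. Qed.

Lemma cvg_summable_increments n (u : nat -> 'cV[R]_n) (M : R) :
  (forall N, \sum_(0 <= k < N) enorm (u k.+1 - u k) <= M) -> cvgn u.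
Proof.
move=> uM; apply: cvg_coordinates => i; apply: (@cvg_bounded_variation _ M) => N.
apply: le_trans (uM N); apply: ler_sum => k _.
rewrite -[leRHS]ger0_norm ?enorm_ge0// -ler_sqr ?nnegrE// !real_normK ?num_real//.
by rewrite enorm_sqr; have := sqr_coord_le (u k.+1 - u k) i; rewrite !mxE.
Qed.

End SummableIncrements.

(** * Almost sure convergence from expected increments *)

Section AlmostSureConvergence.
Context {d : measure_display} {T : measurableType d} {R : realType}.
Variable P : probability T R.

(** Exchanging sum and integral bounds the expected length of the path by [C / (1 - s)], so that
    length is finite almost everywhere. *)
Lemma ae_cvg_geometric_increments n (x : nat -> T -> 'cV[R]_n) (C s : R) :
  0 <= C -> 0 <= s < 1 ->
  (forall k, measurable_fun setT (fun w => enorm (x k.+1 w - x k w))) ->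
  (forall k, ('E_P[fun w => enorm (x k.+1 w - x k w)] <= (C * s ^+ k)%:E)%E) ->
  {ae P, forall w, cvg (x k w @[k --> \oo])}.
Proof.
move=> C0 /andP[s0 s1] mx Ex.
pose e k : T -> \bar R := EFin \o (fun w => enorm (x k.+1 w - x k w)).
have e0 k w : (0 <= e k w)%E by rewrite lee_fin enorm_ge0.
have me k : measurable_fun setT (e k) by exact/measurable_EFinP.
have me_sum := @ge0_emeasurable_sum _ T R setT e xpredT
  (fun k w _ _ => e0 k w) (fun k _ => me k).
have int_sum : P.-integrable setT (fun w => \sum_(0 <= k <oo) e k w)%E.
  apply/integrableP; split => //.
  rewrite (eq_integral (fun w => \sum_(0 <= k <oo) e k w)%E); last first.
    by move=> w _; rewrite gee0_abs// nneseries_ge0.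
  rewrite integral_nneseries//; apply: (@le_lt_trans _ _ (C / (1 - s))%:E); last first.
    exact: ltry.
  apply: lime_le; first by apply: is_cvg_nneseries => k _ _; exact: integral_ge0.
  apply: nearW => N.
  apply: (@le_trans _ _ (\sum_(0 <= k < N) (C * s ^+ k)%:E)%E).
    by apply: lee_sum => k _; have := Ex k; rewrite unlock.
  rewrite sumEFin lee_fin.
  have := geometric_seriesE C (negbT (lt_eqF s1)); rewrite /series /=.
  move=> /(congr1 (@^~ N)) /= ->.
  rewrite ler_pM2r ?invr_gt0 ?subr_gt0// mulrDr mulr1 gerDl mulrN oppr_le0.
  by rewrite mulr_ge0// exprn_ge0.
have := integrable_ae measurableT int_sum; apply: filterS => w /(_ I) wfin.
apply: (@cvg_summable_increments _ _ _ (fine (\sum_(0 <= k <oo) e k w)%E)) => N.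
rewrite -lee_fin fineK// -sumEFin.
exact: (@nneseries_lim_ge _ (e^~ w) xpredT 0 N (fun k _ _ => e0 k w)).
Qed.

End AlmostSureConvergence.

(** By choice of a preimage; [u0] is the value off the range of [X]. *)
Lemma factor_through (T S : Type) (U : Type) (X : T -> S) (f : T -> U) (u0 : U) :
  (forall w w', X w = X w' -> f w = f w') ->
  exists g : S -> U, forall w, f w = g (X w).
Proof.
move=> fX; exists (fun s => if pselect (exists w, X w = s) is left ex
  then f (projT1 (cid ex)) else u0) => w.
case: pselect => [ex|[]]; last by exists w.
by apply: fX; case: cid => w' /= ->.
Qed.

(** * Iterates as functions of the history, and the recursion in expectation *)

Section Trajectories.
Context {d : measure_display} {T : measurableType d} {R : realType}.
Variable P : probability T R.
Context {m n : nat}.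
Variables (A : 'M[R]_(m, n)) (b : 'cV[R]_m) (beta : nat) (delta gamma : R).
Variables (x0 : 'cV[R]_n) (tau : nat -> T -> {set 'I_m}) (i : nat -> T -> 'I_m).
Variables (j : nat -> T -> 'I_n) (x : nat -> T -> 'cV[R]_n).
Hypothesis sskm : is_SSKM P A b beta delta gamma x0 tau i j x.

Lemma random_history k : random_element (history tau i j k).
Proof.
apply: random_element_point => s.
have rl l : random_element (fun w => (tau l.+1 w, i l.+1 w, j l.+1 w)).
  apply: random_element_pair; last exact: sskm_j_random sskm l.
  by apply: random_element_pair;
    [exact: sskm_tau_random sskm l|exact: sskm_i_random sskm l].
rewrite (_ : _ @^-1` _ = \bigcap_(l in [set: 'I_k])
  (fun w => (tau l.+1 w, i l.+1 w, j l.+1 w)) @^-1` [set s l]).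
  by apply: fin_bigcap_measurable => [|l _]; [exact: finite_finset|exact: rl].
apply/seteqP; split => [w /= <- l _|w /= ws]; first by rewrite /= ffunE.
by apply/ffunP => l; rewrite ffunE; exact: ws.
Qed.

(** Two consecutive iterates are carried through the induction because the momentum term uses
    both. *)
Lemma iterates_history k w w' :
  history tau i j k w = history tau i j k w' ->
  x k.+1 w = x k.+1 w' /\ x k w = x k w'.
Proof.
elim: k => [|k IH] hw; first by rewrite !(sskm_init0 sskm) !(sskm_init1 sskm).
have hk l : (l < k.+1)%N -> (tau l.+1 w, i l.+1 w, j l.+1 w) =
                           (tau l.+1 w', i l.+1 w', j l.+1 w').
  by move=> lk; move/ffunP/(_ (Ordinal lk)): hw; rewrite !ffunE.
have [x1 x2] : x k.+1 w = x k.+1 w' /\ x k w = x k w'.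
  by apply: IH; apply/ffunP => l; rewrite !ffunE hk// ltnS ltnW.
have [_ ik jk] := hk k (ltnSn k).
by rewrite !(sskm_step sskm) x1 x2 ik jk.
Qed.

(** The history has finitely many values, so any function of these iterates is measurable and its
    expectation is a finite sum. *)
Lemma iterates_factor k : exists Phi : _ -> 'cV[R]_n * 'cV[R]_n,
  forall w, (x k.+1 w, x k w) = Phi (history tau i j k w).
Proof.
apply: factor_through; first exact: (0, 0).
by move=> w w' /iterates_history[-> ->].
Qed.

Definition expect (f : T -> R) : R := fine ('E_P[f])%E.

Lemma expectE (S : finType) (X : T -> S) (g : S -> R) (f : T -> R) :
  random_element X -> (forall w, f w = g (X w)) -> expect f = mean P X g.
Proof.
move=> rX fg; rewrite /expect (_ : f = fun w => g (X w)); last exact/funext.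
by rewrite expectation_mean.
Qed.

Section IteratesFactor.
Variables (k : nat) (Phi : {ffun 'I_k -> {set 'I_m} * 'I_m * 'I_n} ->
  'cV[R]_n * 'cV[R]_n).
Hypothesis PhiE : forall w, (x k.+1 w, x k w) = Phi (history tau i j k w).

Lemma expect_iterates (g : 'cV[R]_n -> 'cV[R]_n -> R) :
  expect (fun w => g (x k.+1 w) (x k w)) =
  mean P (history tau i j k) (fun h => g (Phi h).1 (Phi h).2).
Proof. by apply: expectE => [|w]; [exact: random_history|rewrite -PhiE]. Qed.

End IteratesFactor.

Lemma expectation_iterates k (g : 'cV[R]_n -> 'cV[R]_n -> R) :
  ('E_P[fun w => g (x k.+1 w) (x k w)] =
   (expect (fun w => g (x k.+1 w) (x k w)))%:E)%E.
Proof.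
have [Phi PhiE] := iterates_factor k.
rewrite (expect_iterates PhiE) -expectation_mean; last exact: random_history.
by congr expectation; apply/funext => w; rewrite -PhiE.
Qed.

Lemma le_expect_iterates k (f g : 'cV[R]_n -> 'cV[R]_n -> R) :
  (forall y z, f y z <= g y z) ->
  expect (fun w => f (x k.+1 w) (x k w)) <= expect (fun w => g (x k.+1 w) (x k w)).
Proof.
have [Phi PhiE] := iterates_factor k => fg.
by rewrite (expect_iterates PhiE f) (expect_iterates PhiE g) le_mean.
Qed.

Lemma expect_iteratesD k (f g : 'cV[R]_n -> 'cV[R]_n -> R) (a c : R) :
  expect (fun w => a * f (x k.+1 w) (x k w) + c * g (x k.+1 w) (x k w)) =
  a * expect (fun w => f (x k.+1 w) (x k w)) +
  c * expect (fun w => g (x k.+1 w) (x k w)).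
Proof.
have [Phi PhiE] := iterates_factor k.
rewrite (expect_iterates PhiE f) (expect_iterates PhiE g).
rewrite (expect_iterates PhiE (fun y z => a * f y z + c * g y z)).
by rewrite meanD !meanZ.
Qed.

Lemma expect_iteratesZ k (f : 'cV[R]_n -> 'cV[R]_n -> R) (a : R) :
  expect (fun w => a * f (x k.+1 w) (x k w)) =
  a * expect (fun w => f (x k.+1 w) (x k w)).
Proof.
have [Phi PhiE] := iterates_factor k.
rewrite (expect_iterates PhiE f).
by rewrite (expect_iterates PhiE (fun y z => a * f y z)) meanZ.
Qed.

Lemma expect_cst c : expect (fun=> c) = c.
Proof. by rewrite /expect expectation_cst. Qed.

Lemma measurable_iterates k (g : 'cV[R]_n -> 'cV[R]_n -> R) :
  measurable_fun setT (fun w => g (x k.+1 w) (x k w)).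
Proof.
have [Phi PhiE] := iterates_factor k.
move=> _ B _; rewrite setTI.
rewrite (_ : _ @^-1` B =
  history tau i j k @^-1` [set h | B (g (Phi h).1 (Phi h).2)]).
  exact: random_history.
by apply/seteqP; split => w /=; rewrite -PhiE.
Qed.

Hypothesis unit_rows : forall i, enorm (arow A i) = 1.
Hypothesis feasible : polyhedron A b !=set0.
Hypotheses (beta_gt0 : (0 < beta)%N) (beta_le_m : (beta <= m)%N).
Hypotheses (delta_gt0 : 0 < delta) (gamma_ge0 : 0 <= gamma) (n_gt0 : (0 < n)%N).
Variable t : R.
Hypothesis t_ge0 : 0 <= t.

Let dist2 k := expect (fun w => edistance (x k w) (polyhedron A b) ^+ 2).
Let incr2 k := expect (fun w => dotv (x k.+1 w - x k w) (x k.+1 w - x k w)).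
Let obj k := expect (fun w => 2 * sskm_f A b beta (x k w)).

(** Average the one-step bound over [j] given the history, [tau] and [i], then over [tau] given the
    history. Between the two, [i] disappears because the bound [G] does not depend on it, whatever
    the tie-breaking. *)
Lemma sskm_momentum_recursion k :
  let g := gamma / n%:R in
  dist2 k.+2 + t * incr2 k.+1 <=
    (1 + g) * dist2 k.+1 - g * dist2 k
    + (gamma + gamma ^+ 2 * (1 + t)) / n%:R * incr2 k
    - (2 * delta - delta ^+ 2 * (1 + t) + (1 + t) * g * delta) * obj k.+1
    + (1 + t) * g * delta * obj k.
Proof.
set g := gamma / n%:R; cbv zeta.
set c := _ / n%:R; set p := _ - _ + _ * delta; set q := _ * delta.
have g0 : 0 <= g by rewrite divr_ge0.
have [Phi PhiE] := iterates_factor k.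
pose H := history tau i j k; have rH : random_element H := @random_history k.
pose D2 y := edistance y (polyhedron A b) ^+ 2.
have PhiE1 w : x k.+1 w = (Phi (H w)).1 by rewrite -PhiE.
have PhiE2 w : x k w = (Phi (H w)).2 by rewrite -PhiE.
apply/ler_addgt0Pr => e e0.
(* The slack of the near-minimizer is later multiplied by [1 + g]. *)
pose e' := e / (1 + g); have e'0 : 0 < e' by rewrite divr_gt0// ltr_wpDr.
have ee' : (1 + g) * e' = e by rewrite mulrC divfK// gt_eqF// ltr_wpDr.
(* The reference point is a function of the history alone, so it stays fixed while averaging over
   [j] and [tau]. *)
have /choice[z zP] : forall h, exists z, polyhedron A b z /\
    dotv ((Phi h).1 - z) ((Phi h).1 - z) <= D2 (Phi h).1 + e'.
  by move=> h; have [z] := sqr_edistance_approx feasible (Phi h).1 e'0; exists z.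
pose X w := (H w, tau k.+1 w, i k.+1 w).
have [rj rt] : random_element (j k.+1) /\ random_element (tau k.+1).
  by split; [exact: sskm_j_random sskm k|exact: sskm_tau_random sskm k].
have rX : random_element X.
  apply: random_element_pair; last exact: sskm_i_random sskm k.
  exact: random_element_pair.
have rXj := random_element_pair rX rj.
have [uj ut] := (sskm_j_uniform sskm k, sskm_tau_uniform sskm k).
have [ij it] : independent_elements P (j k.+1) X /\
    independent_elements P (tau k.+1) H.
  by split; [exact: sskm_j_indep sskm k|exact: sskm_tau_indep sskm k].
pose next (s : _ * {set 'I_m} * 'I_m) l :=
  sskm_next A b delta gamma (Phi s.1.1).1 (Phi s.1.1).2 s.2 l.
have nextE w : x k.+2 w = next (X w) (j k.+1 w).
  by rewrite (sskm_step sskm) PhiE1 PhiE2.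
pose V (s : _ * {set 'I_m} * 'I_m) l :=
  dotv (next s l - z s.1.1) (next s l - z s.1.1)
  + t * dotv (next s l - (Phi s.1.1).1) (next s l - (Phi s.1.1).1).
pose G h (ta : {set 'I_m}) := (1 + g) * (D2 (Phi h).1 + e') - g * D2 (Phi h).2
  + c * dotv ((Phi h).1 - (Phi h).2) ((Phi h).1 - (Phi h).2)
  - p * max_residual A b ta (Phi h).1 ^+ 2 + q * max_residual A b ta (Phi h).2 ^+ 2.
apply: (@le_trans _ _ (mean P (fun w => (X w, j k.+1 w)) (fun s => V s.1 s.2))).
  rewrite /dist2 /incr2.
  rewrite (@expectE _ _ (fun s => D2 (next s.1 s.2)) _ rXj); last first.
    by move=> w; rewrite nextE.
  rewrite (@expectE _ _ (fun s => dotv (next s.1 s.2 - (Phi s.1.1.1).1)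
     (next s.1 s.2 - (Phi s.1.1.1).1)) _ rXj); last first.
    by move=> w; rewrite nextE PhiE1.
  rewrite -meanZ -meanD; apply: le_mean => w; rewrite lerD2r.
  by apply: sqr_edistance_le => //; have [] := zP (H w).
rewrite (mean_uniform_indep _ rX rj uj ij).
rewrite cardsT card_ord.
apply: (@le_trans _ _ (mean P X (fun s => G s.1.1 s.1.2))).
  apply: le_mean => w.
  have [itau imax] := sskm_argmax sskm k w.
  have [zPk zle] := zP (H w).
  have imax' l : l \in tau k.+1 w ->
      residual A b (Phi (H w)).1 l <= residual A b (Phi (H w)).1 (i k.+1 w).
    by rewrite -PhiE1; exact: imax.
  under eq_bigl do rewrite inE.
  apply: le_trans (mean_sskm_next_le unit_rows n_gt0 delta_gt0 gamma_ge0 t_ge0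
    (Phi (H w)).2 zPk itau imax') _.
  (* Near-minimality of [z] serves the term in the current iterate; the previous one has the
     coefficient [- g], so there the distance being an infimum suffices. *)
  rewrite -/g -/c -/p -/q /G /= !lerD2r lerB//.
    by rewrite ler_wpM2l// addr_ge0.
  by rewrite ler_wpM2l//; exact: sqr_edistance_le.
rewrite -(@mean_comp _ _ _ P _ _ X fst (fun s => G s.1 s.2) rX).
rewrite (mean_uniform_indep _ rH rt ut it).
rewrite (@eq_mean _ _ _ P _ H _ (fun h =>
   (1 + g) * D2 (Phi h).1 + (- g * D2 (Phi h).2
   + (c * dotv ((Phi h).1 - (Phi h).2) ((Phi h).1 - (Phi h).2)
   + (- p * (2 * sskm_f A b beta (Phi h).1)
   + (q * (2 * sskm_f A b beta (Phi h).2) + e)))))); last first.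
  move=> w; rewrite !sskm_fE /G -ee'.
  by rewrite mean_samples_affine//; ring.
rewrite !meanD (mean_cst P rH).
rewrite /dist2 /incr2 /obj.
rewrite (expect_iterates PhiE (fun y _ => D2 y)).
rewrite (expect_iterates PhiE (fun _ y => D2 y)).
rewrite (expect_iterates PhiE (fun y z => dotv (y - z) (y - z))).
rewrite (expect_iterates PhiE (fun y _ => 2 * sskm_f A b beta y)).
rewrite (expect_iterates PhiE (fun _ y => 2 * sskm_f A b beta y)).
rewrite -/H !meanZ; lra.
Qed.

End Trajectories.

(** The bound on [gamma] is the positive root of [(1 + t) X^2 + X - n t]; completing the square
    brings in the factor [4 (1 + t)]. *)
Lemma momentum_bound (R : realType) (n : nat) (gamma t : R) :
  0 <= gamma -> 0 <= t ->
  gamma < (- 1 + Num.sqrt (4 * n%:R * t + 4 * n%:R * t ^+ 2 + 1)) / (2 * (1 + t)) ->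
  gamma + gamma ^+ 2 * (1 + t) < n%:R * t.
Proof.
move=> g0 t0; have t1 : 0 < 2 * (1 + t) by lra.
rewrite ltr_pdivlMr// => h.
set r := 4 * _ * _ + _ + _ in h.
have r0 : 0 <= r by rewrite /r !addr_ge0// !mulr_ge0// ?ler0n ?sqr_ge0.
have gt0 : 0 <= gamma * (2 * (1 + t)) by rewrite mulr_ge0// ltW.
have := ltr_pXn2r (n := 2) isT; have := sqr_sqrtr r0.
have := sqrtr_ge0 r; set q := Num.sqrt r in h *; move=> q0 qq _.
have : (gamma * (2 * (1 + t)) + 1) ^+ 2 < q ^+ 2.
  by rewrite ltr_pXn2r ?nnegrE//; lra.
rewrite qq /r => sq.
rewrite -(@ltr_pM2l _ (4 * (1 + t))); last by lra.
rewrite -subr_gt0 in sq; rewrite -subr_gt0; move: sq; congr (_ < _); ring.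
Qed.

(** * Almost sure convergence of the iterates *)

Section Convergence.
Context {d : measure_display} {T : measurableType d} {R : realType}.
Variable P : probability T R.
Context {m n : nat}.
Variables (A : 'M[R]_(m, n)) (b : 'cV[R]_m) (beta : nat) (delta gamma : R).
Variables (x0 : 'cV[R]_n) (tau : nat -> T -> {set 'I_m}) (i : nat -> T -> 'I_m).
Variables (j : nat -> T -> 'I_n) (x : nat -> T -> 'cV[R]_n).
Hypothesis sskm : is_SSKM P A b beta delta gamma x0 tau i j x.

(* AM-GM: 2 |v| <= r^k + |v|^2 / r^k with r = sqrt s. *)
Lemma sskm_ae_cvg (B s : R) : 0 <= B -> 0 < s < 1 ->
  (forall k, expect P (fun w => dotv (x k.+1 w - x k w) (x k.+1 w - x k w))
    <= B * s ^+ k) ->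
  {ae P, forall w, cvg (x k w @[k --> \oo])}.
Proof.
move=> B0 /andP[s0 s1] incr_le; pose r := Num.sqrt s.
have r0 : 0 < r by rewrite sqrtr_gt0.
have rr : r ^+ 2 = s by rewrite sqr_sqrtr// ltW.
have r1 : r < 1 by rewrite -(ltr_pXn2r (n := 2)) ?nnegrE ?ltW// rr expr1n.
apply: (@ae_cvg_geometric_increments _ _ _ _ _ _ ((1 + B) / 2) r).
- by rewrite divr_ge0// addr_ge0.
- by rewrite ltW.
- by move=> k; exact: (measurable_iterates sskm k (fun y z => enorm (y - z))).
move=> k; rewrite (expectation_iterates sskm k (fun y z => enorm (y - z))).
rewrite lee_fin; have rk : 0 < r ^+ k by rewrite exprn_gt0.
apply: (@le_trans _ _ (expect P (fun w => r ^+ k / 2 * 1 +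
    (2 * r ^+ k)^-1 * dotv (x k.+1 w - x k w) (x k.+1 w - x k w)))).
  apply: (le_expect_iterates sskm k (f := fun y z => enorm (y - z))
    (g := fun y z => r ^+ k / 2 * 1 + (2 * r ^+ k)^-1 * dotv (y - z) (y - z))).
  move=> y z; rewrite -enorm_sqr; set e := enorm _; set q := r ^+ k in rk *.
  rewrite -subr_ge0.
  have -> : q / 2 * 1 + (2 * q)^-1 * e ^+ 2 - e = (q - e) ^+ 2 / (2 * q).
    by field; rewrite gt_eqF.
  by rewrite divr_ge0 ?sqr_ge0// mulr_ge0// ltW.
rewrite (expect_iteratesD sskm k (fun _ _ => 1) (fun y z => dotv (y - z) (y - z))).
rewrite expect_cst mulr1.
have := incr_le k; rewrite -rr -exprM mulnC exprM; set q := r ^+ k in rk *.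
move=> h; have q2 : 0 <= (2 * q)^-1 by rewrite invr_ge0 mulr_ge0// ltW.
have := ler_wpM2l q2 h.
have -> : (2 * q)^-1 * (B * q ^+ 2) = B / 2 * q by field; rewrite gt_eqF.
lra.
Qed.

End Convergence.

Unset Implicit Arguments.

Theorem theorem6p17 (R : realType) (m n : nat)
  (A : 'M[R]_(m, n)) (b : 'cV[R]_m)
  (unit_rows : forall i, enorm (arow A i) = 1)
  (feasible : polyhedron A b !=set0)
  (beta : nat) (beta_gt0 : (0 < beta)%N) (beta_le_m : (beta <= m)%N)
  (L : R) (hoffman : hoffman_constant A b L)
  (delta gamma t2 : R)
  (delta_gt0 : 0 < delta) (delta_lt2 : delta < 2)
  (gamma_ge0 : 0 <= gamma) (t2_ge0 : 0 <= t2)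
  (gamma_lt : gamma < (- 1 + Num.sqrt (4 * n%:R * t2 + 4 * n%:R * t2 ^+ 2 + 1))
                      / (2 * (1 + t2)))
  (momentum_lt : gamma * mu2 A beta / mu1 m L
                 < 2 * n%:R / (1 + t2) - n%:R * delta + gamma)
  (momentum_le : 2 * n%:R / (1 + t2) - n%:R * delta + gamma
                 <= (n%:R + gamma) / (delta * mu1 m L * (1 + t2))) :
  exists alpha rho : R, [/\ 0 <= alpha, 0 < rho, rho < 1 &
    forall (d : measure_display) (T : measurableType d) (P : probability T R)
      (x0 : 'cV[R]_n) (tau : nat -> T -> {set 'I_m}) (i : nat -> T -> 'I_m)
      (j : nat -> T -> 'I_n) (x : nat -> T -> 'cV[R]_n),
    is_SSKM P A b beta delta gamma x0 tau i j x ->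
    {ae P, forall w, cvg (x k w @[k --> \oo])} /\
    forall k : nat,
      ('E_P[fun w => (edistance (x k.+1 w) (polyhedron A b) ^+ 2)%R]
         <= (rho ^+ k * (1 + alpha)
             * edistance x0 (polyhedron A b) ^+ 2)%:E)%E /\
      ('E_P[fun w => sskm_f A b beta (x k.+1 w)]
         <= (mu2 A beta * (1 + alpha) / 2 * rho ^+ k
             * edistance x0 (polyhedron A b) ^+ 2)%:E)%E].
Proof.
have c_lt := momentum_bound gamma_ge0 t2_ge0 gamma_lt.
move: t2 t2_ge0 {gamma_lt momentum_le} momentum_lt c_lt => t t_ge0 momentum_lt c_lt.
(* For [n = 0] the right side of [c_lt] would vanish while its left side is nonnegative; [t = 0] is
   excluded in the same way. *)
have n_gt0 : (0 < n)%N.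
  rewrite lt0n; apply: contraTneq c_lt => ->; rewrite mul0r -leNgt.
  by rewrite !addr_ge0// mulr_ge0 ?sqr_ge0 ?addr_ge0.
have nR : 0 < n%:R :> R by rewrite ltr0n.
have n1 : 1 <= n%:R :> R by rewrite ler1n.
have t_gt0 : 0 < t.
  rewrite lt_neqAle t_ge0 andbT; apply: contraTneq c_lt => <-.
  by rewrite mulr0 -leNgt; have := sqr_ge0 gamma; lra.
have m1_gt0 : 0 < mu1 m L := mu1_gt0 beta_gt0 beta_le_m hoffman.
have m12 := mu1_le_mu2 unit_rows feasible beta_gt0 beta_le_m hoffman.
have m2_ge0 : 0 <= mu2 A beta by exact: le_trans (ltW m1_gt0) m12.
(* As [mu1 <= mu2], the left side of [momentum_lt] is at least [gamma], which then cancels. *)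
have delta_t : delta * (1 + t) < 2.
  have h : gamma <= gamma * mu2 A beta / mu1 m L.
    by rewrite -mulrA ler_peMr// ler_pdivlMr// mul1r.
  have := le_lt_trans h momentum_lt => h2.
  have : n%:R * delta < 2 * n%:R / (1 + t) by lra.
  rewrite ltr_pdivlMr; last by lra.
  by rewrite -mulrA [2 * _]mulrC ltr_pM2l.
pose g := gamma / n%:R.
have g0 : 0 <= g by rewrite divr_ge0// ltW.
(* If [gamma >= n >= 1], then [gamma^2 >= n], and [gamma^2 (1 + t) >= n t] contradicts [c_lt]. *)
have g1 : g < 1.
  rewrite /g ltr_pdivrMr// mul1r ltNge; apply/negP => ng.
  have ng2 : n%:R <= gamma ^+ 2.
    by apply: (le_trans ng); rewrite expr2 ler_peMr// (le_trans n1 ng).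
  have := ler_wpM2r t_ge0 ng2; have := sqr_ge0 gamma; lra.
have c_lt_t : (gamma + gamma ^+ 2 * (1 + t)) / n%:R < t.
  by rewrite ltr_pdivrMr// [ltRHS]mulrC.
pose q0 := (1 + t) * g * delta; pose p := 2 * delta - delta ^+ 2 * (1 + t) + q0.
have q0_ge0 : 0 <= q0 by rewrite !mulr_ge0// ?ltW//; lra.
(* The gap is [delta (2 - delta (1 + t))]. *)
have q0p : q0 < p.
  by rewrite /p ltrDr; have := mulr_gt0 delta_gt0 (_ : 0 < 2 - delta * (1 + t)); nra.
have g01 : 0 <= g < 1 by rewrite g0.
have q0p01 : 0 <= q0 < p by rewrite q0_ge0.
(* Both constants are fixed before the probability space and the starting point are introduced. *)
have [K [s [K0 s0 s1 rate]]] :=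
  momentum_recursion_rate t_gt0 g01 c_lt_t q0p01 m1_gt0.
exists K, s; split=> // d T P x0 tau i j x sskm.
pose dist2 k := expect P (fun w => edistance (x k w) (polyhedron A b) ^+ 2).
pose incr2 k := expect P (fun w => dotv (x k.+1 w - x k w) (x k.+1 w - x k w)).
have dist2_0 : dist2 0%N = edistance x0 (polyhedron A b) ^+ 2.
  rewrite -[RHS](expect_cst P); congr expect; apply/funext => w.
  by rewrite (sskm_init0 sskm).
have incr2_0 : incr2 0%N = 0.
  rewrite -(expect_cst P 0); congr expect; apply/funext => w.
  by rewrite (sskm_init0 sskm) (sskm_init1 sskm) subrr /dotv big1// => l _;
    rewrite mxE mul0r.
have incr2_ge0 k : 0 <= incr2 k.
  rewrite -(expect_cst P 0).
  apply: (le_expect_iterates sskm k (f := fun _ _ => 0)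
    (g := fun y z => dotv (y - z) (y - z))) => y z; exact: dotvv_ge0.
have dist2_ge0 k : 0 <= dist2 k.
  rewrite -(expect_cst P 0).
  by apply: (le_expect_iterates sskm k (f := fun _ _ => 0)
    (g := fun _ z => edistance z (polyhedron A b) ^+ 2)) => y z; exact: sqr_ge0.
have bound k : dist2 k.+1 + t * incr2 k <=
    s ^+ k * (1 + K) * edistance x0 (polyhedron A b) ^+ 2.
  (* Index shift: [W l] is the increment arriving at [x l], whereas [incr2 l] is the one leaving it;
     [W 1] is thus [incr2 0 = 0]. *)
  rewrite -dist2_0; apply: (rate dist2 (fun l => incr2 l.-1)
    (fun l => expect P (fun w => 2 * sskm_f A b beta (x l w)))) => //.
  - move=> l; apply/andP; split.
      rewrite /dist2 -(expect_iteratesZ sskm l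
        (fun _ z => edistance z (polyhedron A b) ^+ 2)).
      apply: (le_expect_iterates sskm l
        (f := fun _ z => mu1 m L * edistance z (polyhedron A b) ^+ 2)
        (g := fun _ z => 2 * sskm_f A b beta z)) => _ z.
      exact: sskm_f_ge.
    apply: (le_expect_iterates sskm l (f := fun _ z => 2 * sskm_f A b beta z)
      (g := fun _ z => edistance z (polyhedron A b) ^+ 2)) => _ z.
    exact: sskm_f_le_edistance.
  - rewrite /dist2; congr expect; apply/funext => w.
    by rewrite (sskm_init0 sskm) (sskm_init1 sskm).
  - move=> l; exact: (sskm_momentum_recursion sskm).
split.
  (* Dropping the nonnegative distance term in [bound] and dividing by [t] gives this constant for
     the increments. *)
  pose B := (1 + K) * edistance x0 (polyhedron A b) ^+ 2 / t.
  apply: (@sskm_ae_cvg _ _ _ _ _ _ _ _ _ _ _ _ _ _ _ _ sskm B s).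
  - by apply: divr_ge0 => //; apply: mulr_ge0; [lra|exact: sqr_ge0].
  - by rewrite s0.
  move=> k; have := bound k; have := dist2_ge0 k.+1; rewrite -/(incr2 k) => h1 h2.
  have -> : B * s ^+ k = s ^+ k * (1 + K) * edistance x0 (polyhedron A b) ^+ 2 / t.
    by rewrite /B; ring.
  by rewrite ler_pdivlMr//; lra.
move=> k.
have dist2_le : dist2 k.+1 <= s ^+ k * (1 + K) * edistance x0 (polyhedron A b) ^+ 2.
  by apply: le_trans (bound k); rewrite lerDl mulr_ge0// ltW.
split.
  rewrite (expectation_iterates sskm k
    (fun y _ => edistance y (polyhedron A b) ^+ 2)).
  by rewrite lee_fin.
rewrite (expectation_iterates sskm k (fun y _ => sskm_f A b beta y)) lee_fin.
apply: (@le_trans _ _ (mu2 A beta / 2 * dist2 k.+1)).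
  rewrite /dist2 -(expect_iteratesZ sskm k
    (fun y _ => edistance y (polyhedron A b) ^+ 2)).
  apply: (le_expect_iterates sskm k (f := fun y _ => sskm_f A b beta y)
    (g := fun y _ => mu2 A beta / 2 * edistance y (polyhedron A b) ^+ 2)) => y _.
  have := sskm_f_le unit_rows feasible beta_gt0 beta_le_m y; lra.
have m2h : 0 <= mu2 A beta / 2 by lra.
apply: le_trans (ler_wpM2l m2h dist2_le) _.
by rewrite le_eqVlt; apply/orP; left; apply/eqP; ring.
Qed.
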